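(* For all integers $n,d\ge0$, $T(n,\omega^d)\ge P(n,\omega^d)$. Consequently $T(n,\omega^d)=P(n,\omega^d)$.
   Context: $[c]=\{1,\dots,c\}$; ordinals are identified with sets of smaller ordinals; $\approx$ is order-equivalence; $\binom{S}{n}$ is the set of $n$-element subsets. $T(n,S)$ is the least $t\in\mathbb{N}$ such that for every $c\ge1$ and every $\mathrm{COL}:\binom{S}{n}\to[c]$ there is $S'\subseteq S$, $S'\approx S$, with $|\mathrm{COL}(\binom{S'}{n})|\le t$ ($\infty$ if none). Every $\beta<\omega^d\cdot k$ is uniquely $\omega^d b+\sum_{j<d}\omega^j a_j$ with $0\le b<k$, $a_j\in\mathbb{N}$. A coloring rule (CR) on $\binom{\omega^d\cdot k}{n}$ is a pair $(\mathcal{Y},\preceq)$ with $\mathcal{Y}:\{1,\dots,n\}\to\{0,\dots,k-1\}$ and $\preceq$ a total preorder on $I=\{(i,j):1\le i\le n,0\le j<d\}$ (with induced equivalence $\equiv$ and strict part $\prec$) such that: (1) if $d\ge1$, $(i,0)\prec(i',0)$ for $i<i'$; if $d=0$, $\mathcal{Y}(i)<\mathcal{Y}(i')$ for $i<i'$; (2) $(i,j)\equiv(i',j)$ for some $j$ implies $\mathcal{Y}(i)=\mathcal{Y}(i')$; (3) $(i,j)\prec(i,j')$ for $j>j'$; (4) $(i,j)\equiv(i',j')$ implies $j=j'$; (5) for $j>0$, $(i,j)\not\equiv(i',j)$ implies $(i,j-1)\not\equiv(i',j-1)$. $P(n,\omega^d\cdot k)$ is the total number of CRs on $\binom{\omega^d\cdot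 k}{n}$, and $P(n,\omega^d)=P(n,\omega^d\cdot 1)$. *)

(* Defs.v *)
From mathcomp Require Import all_boot all_order.
Set Implicit Arguments. Unset Strict Implicit. Unset Printing Implicit Defensive.

(* The ordinal omega^d, realised via Cantor normal form:                   *)
(*   beta = sum_{j<d} omega^j a_j   <->   (j |-> a_j) : {ffun 'I_d -> nat} *)
(* ordered lexicographically, most significant exponent (largest j) first. *)
Definition Ord (d : nat) := {ffun 'I_d -> nat}.

Definition ord_lt (d : nat) (x y : Ord d) : Prop :=
  exists j : 'I_d, x j < y j /\ (forall j' : 'I_d, j < j' -> x j' = y j').

Definition nsubset (d n : nat) (S : Ord d -> Prop) (s : n.-tuple (Ord d)) : Prop :=
  (forall i i' : 'I_n, i < i' -> ord_lt (tnth s i) (tnth s i')) /\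
  (forall i : 'I_n, S (tnth s i)).

Definition ord_equiv_sub (d : nat) (S' : Ord d -> Prop) : Prop :=
  exists f : Ord d -> Ord d,
    (forall x y, ord_lt x y -> ord_lt (f x) (f y)) /\
    (forall y, S' y <-> exists x, f x = y).

Definition T_ok (n d t : nat) : Prop :=
  forall c : nat, 0 < c ->
  forall COL : n.-tuple (Ord d) -> 'I_c,
  exists S' : Ord d -> Prop,
    ord_equiv_sub S' /\
    exists A : {set 'I_c}, #|A| <= t /\
      (forall s, nsubset S' s -> COL s \in A).

Definition T_is (n d t : nat) : Prop :=
  T_ok n d t /\ forall t', T_ok n d t' -> t <= t'.

(* Coloring rules on [omega^d * k]^n.  Index i in {1..n} is 'I_n (0-based, *)
(* same order); I = 'I_n * 'I_d; the total preorder is a boolean relation. *)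
Definition CRdata (n d k : nat) :=
  ({ffun 'I_n -> 'I_k} * {ffun 'I_n * 'I_d -> {ffun 'I_n * 'I_d -> bool}})%type.

Definition isCR (n d k : nat) (p : CRdata n d k) : bool :=
  let Y := p.1 in
  let le := fun x y : 'I_n * 'I_d => p.2 x y in
  let eqv := fun x y => le x y && le y x in
  let slt := fun x y => le x y && ~~ le y x in
  [&&
      [forall x, le x x],
      [forall x, forall y, forall z, le x y ==> le y z ==> le x z],
      [forall x, forall y, le x y || le y x],
      [forall i : 'I_n, forall i' : 'I_n, (i < i') ==>
         (if d is _.+1 then
            [forall j0 : 'I_d, (val j0 == 0) ==> slt (i, j0) (i', j0)]
          else (Y i < Y i'))],
      [forall i, forall i', forall j : 'I_d, eqv (i, j) (i', j) ==> (Y i == Y i')],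
      [forall i, forall j : 'I_d, forall j' : 'I_d, (j' < j) ==> slt (i, j) (i, j')],
      [forall i, forall i', forall j : 'I_d, forall j' : 'I_d,
         eqv (i, j) (i', j') ==> (j == j')] &
      [forall i, forall i', forall j : 'I_d, forall j' : 'I_d,
         (val j == (val j').+1) ==> ~~ eqv (i, j) (i', j) ==> ~~ eqv (i, j') (i', j')]].

Definition Pk (n d k : nat) : nat := #|[pred p : CRdata n d k | isCR p]|.

Definition P (n d : nat) : nat := Pk n d 1.

(* Main.v *)
Require Import Defs.
From mathcomp Require Import all_boot all_order.
From Stdlib Require Import Classical ClassicalEpsilon.
Set Implicit Arguments. Unset Strict Implicit. Unset Printing Implicit Defensive.

(* List the elements of an [n]-set by increasing coefficient of [omega^0] and record how all
   their coefficients compare.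
   Lower bound: colour each set by this record. A copy of [omega^d] inside [omega^d] contains a
   subtree of height [d] with unbounded branching at every node, and every CR is realized in such
   a subtree by choosing the coefficients greedily in increasing order; so all CRs are colours.
   Upper bound: relabel each coefficient [a_j] of [x] by an injective code of
   [(a_j, ..., a_(d-1))] that increases with [a_j] and when [j] decreases. In the resulting copy
   of [omega^d] the record of every set is a CR. A set is determined by its record and by its
   increasing list of coefficients, so Ramsey's theorem on these lists provides codes for which
   the colour of a set depends on its record only. *)

(** * The infinite Ramsey theorem *)

Definition incr (g : nat -> nat) := {homo g : a b / a < b}.

Lemma incrS (g : nat -> nat) : (forall k, g k < g k.+1) -> incr g.
Proof. exact: homo_ltn ltn_trans. Qed.

Lemma incr_mono (g : nat -> nat) : incr g -> {mono g : a b / a < b}.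
Proof. by move=> gi; apply: leqW_mono; apply: leq_mono. Qed.

Lemma infinite_pigeonhole (C : finType) (c : nat -> C) :
  exists v g, incr g /\ forall k, c (g k) = v.
Proof.
have [v vinf] : exists v, forall N, exists k, (N <= k) && (c k == v).
  apply: NNPP => /not_ex_all_not H.
  have /choice [B HB] : forall v, exists N, forall k, N <= k -> c k <> v.
    move=> v; case: (not_all_ex_not _ _ (H v)) => N HN; exists N => k Nk ck.
    by apply: HN; exists k; rewrite Nk ck eqxx.
  by apply: (HB (c (\max_v B v)) (\max_v B v)) => //; apply: leq_bigmax.
pose nx N := ex_minn (vinf N).
have nxP N : (N <= nx N) && (c (nx N) == v) by rewrite /nx; case: ex_minnP.
pose g := fix g k := if k is k'.+1 then nx (g k').+1 else nx 0.
exists v, g; split; first by apply: incrS => k /=; case/andP: (nxP (g k).+1).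
by case=> [|k] /=; apply/eqP; [case/andP: (nxP 0) | case/andP: (nxP (g k).+1)].
Qed.

Lemma map_range (h : nat -> nat) (e : seq nat) :
  (forall x, x \in e -> exists y, x = h y) -> exists e', e = map h e'.
Proof.
elim: e => [|x e IH] H; first by exists [::].
have [y ->] := H x (mem_head _ _).
have [z ze|e' ->] := IH; first by apply: H; rewrite inE ze orbT.
by exists (y :: e').
Qed.

Theorem infinite_ramsey (C : finType) (m : nat) (f : seq nat -> C) :
  exists g, incr g /\ exists v, forall e, size e = m -> sorted ltn e -> f (map g e) = v.
Proof.
elim: m f => [|m IH] f.
  by exists id; split=> //; exists (f [::]) => e /size0nil ->.
(* Thin the tail of [h] so that sets with least element [h 0] all get one colour. The hypothesis
   [incr h] sits under the existential so that [choice] gives a total function [nxt]. *)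
have step (h : nat -> nat) : exists hv : (nat -> nat) * C, incr h ->
    [/\ incr hv.1, forall x, exists y, hv.1 x = h y.+1 &
     forall e, size e = m -> sorted ltn e -> f (h 0 :: map hv.1 e) = hv.2].
  have [g [gi [v gv]]] := IH (fun e => f (h 0 :: map (h \o S) e)).
  exists (h \o S \o g, v) => hi; split=> [a b ab|x|e se oe] /=.
  - by apply: hi; rewrite ltnS gi.
  - by exists (g x).
  - by rewrite map_comp gv.
have {step} /choice [nxt nxtP] := step.
pose H k := iter k (fun h => (nxt h).1) id.
have Hi k : incr (H k) by elim: k => //= k; case/nxtP.
have Hr k l : k < l -> forall x, exists y, H l x = H k y.+1.
  elim: l => // l IHl; rewrite ltnS leq_eqVlt => /orP[/eqP->|/IHl Hl] x /=.
    by have [_ /(_ x)] := nxtP _ (Hi l).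
  by have [_ /(_ x) [y ->] _] := nxtP _ (Hi l); apply: Hl.
(* Diagonal sequence: the colour of a set with least element [A k] depends only on [k], since its
   other elements lie in the range of [H k.+1]. The pigeonhole principle then removes the dependence
   on [k]. *)
pose A k := H k 0.
have Ai : incr A by move=> a b /Hr/(_ 0) [y Hy]; rewrite /A Hy; apply: Hi.
have [v [g [gi gv]]] := infinite_pigeonhole (fun k => (nxt (H k)).2).
exists (A \o g); split; first by move=> a b ab; apply/Ai/gi.
exists v => -[|k e] //= [se] oe.
have oAe : sorted ltn (map (A \o g) e).
  by rewrite (mono_sorted (incr_mono _)) ?(path_sorted oe) // => a b ab; apply/Ai/gi.
have [x|e' Ee] := @map_range (H (g k).+1) (map (A \o g) e).
  case/mapP=> l le -> /=.
  have /gi : k < l by apply: (allP (order_path_min ltn_trans oe)).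
  rewrite leq_eqVlt => /orP[/eqP<-|/Hr/(_ 0) [y Hy]]; first by exists 0.
  by exists y.+1.
rewrite Ee -(gv k); have [_ _ ->] // := nxtP _ (Hi (g k)).
  by rewrite -(size_map (H (g k).+1)) -Ee size_map.
by rewrite -(mono_sorted (incr_mono (Hi (g k).+1))) -Ee.
Qed.

(** * Copies of omega^d contain large subtrees *)

Definition ltb d (x y : Ord d) : bool :=
  [exists j, (x j < y j) && [forall j' : 'I_d, (j < j') ==> (x j' == y j')]].

Lemma ltbP d (x y : Ord d) : reflect (ord_lt x y) (ltb x y).
Proof.
apply: (iffP existsP) => -[j].
  case/andP=> xy /forallP H; exists j; split=> // j' jj'.
  by apply/eqP; have:= H j'; rewrite jj'.
case=> xy H; exists j; rewrite xy; apply/forallP => j'.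
by apply/implyP => /H->.
Qed.

Lemma ord_lt_irr d (x : Ord d) : ~ ord_lt x x.
Proof. by case=> j []; rewrite ltnn. Qed.

Lemma ord_lt_trans d (y x z : Ord d) : ord_lt x y -> ord_lt y z -> ord_lt x z.
Proof.
move=> [j [xy Hj]] [k [yz Hk]].
case: (ltngtP j k) => [jk|kj|/val_inj jk].
- exists k; rewrite Hj //; split=> // l kl.
  by rewrite Hj ?Hk // (ltn_trans jk).
- exists j; rewrite -Hk //; split=> // l jl.
  by rewrite Hj ?Hk // (ltn_trans kj).
- subst k; exists j; split; first exact: ltn_trans xy yz.
  by move=> l jl; rewrite Hj ?Hk.
Qed.

Lemma ord_lt_total d (x y : Ord d) : x <> y -> ord_lt x y \/ ord_lt y x.
Proof.
move=> xy; have [j0 nj0] : exists j0, x j0 != y j0.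
  apply/existsP; apply: contra_notT xy => /existsPn H.
  by apply/ffunP => j; apply/eqP; rewrite -[_ == _]negbK H.
case: (arg_maxnP (P := fun j => x j != y j) (fun j : 'I_d => val j) nj0) => j nj jmax.
have top (k : 'I_d) : j < k -> x k = y k.
  by move=> jk; apply/eqP; apply: contraLR jk => /jmax; rewrite -leqNgt.
case: (ltngtP (x j) (y j)) nj => // lt_xy _; [left|right]; exists j; split=> // k jk.
by rewrite top.
Qed.

Definition leb d (x y : Ord d) := (x == y) || ltb x y.

Lemma leb_trans d : transitive (@leb d).
Proof.
move=> y x z /orP[/eqP->//|xy] /orP[/eqP<-|yz]; first by rewrite /leb xy orbT.
by apply/orP; right; apply/ltbP/(ord_lt_trans (elimT (ltbP _ _) xy))/ltbP.
Qed.

Lemma leb_total d : total (@leb d).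
Proof.
move=> x y; rewrite /leb; case: (eqVneq x y) => //= /eqP.
by case/ord_lt_total=> /ltbP ->; rewrite ?orbT.
Qed.

Lemma leb_anti d : antisymmetric (@leb d).
Proof.
move=> x y /andP[/orP[/eqP//|/ltbP xy] /orP[/eqP//|/ltbP yx]].
by case: (ord_lt_irr (ord_lt_trans xy yx)).
Qed.

(** For [j <= d], its classes are the blocks of order type omega^j, that is, the nodes at height [j]
    of the tree of coefficients. *)
Definition agree d (j : nat) (x y : Ord d) := forall k : 'I_d, j <= k -> x k = y k.

Definition upd d (x : Ord d) (j v : nat) : Ord d :=
  [ffun k : 'I_d => if val k == j then v else x k].

Lemma agree_upd d (x y : Ord d) (j v : nat) :
  agree j.+1 x y -> agree j (upd x j v) (upd y j v).
Proof.
move=> xy k jk; rewrite !ffunE; case: eqP => // /eqP kj.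
by apply: xy; rewrite ltn_neqAle eq_sym kj.
Qed.

(* [S] contains infinitely branching subtrees: the coordinates of [x] from [j] on are
   fixed, and each lower coordinate, from the top down, can be chosen arbitrarily large. *)
Fixpoint large d (S : Ord d -> Prop) (j : nat) (x : Ord d) : Prop :=
  if j is j'.+1 then forall N, exists v, N < v /\ large S j' (upd x j' v) else S x.

Lemma large_agree d (S : Ord d -> Prop) j x y : agree j x y -> large S j x -> large S j y.
Proof.
elim: j x y => [|j IH] x y xy /= Lx; first by have <- : x = y by apply/ffunP => k; apply: xy.
move=> N; have [v [Nv Lv]] := Lx N; exists v; split=> //.
by apply: IH Lv; apply: agree_upd.
Qed.

Lemma large_upper d (S : Ord d -> Prop) j z : large S j z -> exists2 y, S y & agree j y z.
Proof.
elim: j z => [|j IH] z /=; first by exists z.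
case/(_ 0) => v [_ /IH[y Sy yz]]; exists y => // k jk.
by rewrite yz ?(ltnW jk) // ffunE gtn_eqF.
Qed.

(** For [j > 0], choosing the coordinate just below [j] larger than that of [w] puts [y] above [w].
    For [j = 0] the block is a single point. *)
Lemma large_cofinal d (S : Ord d -> Prop) j z w : j <= d -> agree j w z -> large S j z ->
  exists2 y, S y & agree j y z /\ ~ ord_lt y w.
Proof.
case: j => [|j] jd wz /=.
  have -> : w = z by apply/ffunP => k; apply: wz.
  by move=> Sz; exists z => //; split=> //; apply: ord_lt_irr.
pose jo := Ordinal jd.
move=> /(_ (w jo)) [v [wv /large_upper[y Sy yz]]].
have yz' : agree j.+1 y z by move=> k jk; rewrite yz ?(ltnW jk) // ffunE gtn_eqF.
exists y => //; split=> // yw.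
apply: (@ord_lt_irr _ w); apply: ord_lt_trans yw; exists jo.
rewrite yz // ffunE eqxx; split=> // k jk.
by rewrite wz // yz'.
Qed.

Lemma agree_trans d j (y x z : Ord d) : agree j x y -> agree j y z -> agree j x z.
Proof. by move=> xy yz k jk; rewrite xy // yz. Qed.

Lemma agreeW d i j (x z : Ord d) : i <= j -> agree i x z -> agree j x z.
Proof. by move=> ij xz k jk; rewrite xz // (leq_trans ij). Qed.

Lemma agree_upd_self d j (x : Ord d) v : agree j.+1 (upd x j v) x.
Proof. by move=> k jk; rewrite ffunE gtn_eqF. Qed.

Lemma agree_updr d j (jd : j < d) (x z : Ord d) (v : nat) :
  agree j.+1 x z -> x (Ordinal jd) = v -> agree j x (upd z j v).
Proof.
move=> xz xv k jk; rewrite ffunE; case: eqP => [kj|/eqP kj].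
  by rewrite -xv; congr (x _); apply: val_inj.
by apply: xz; rewrite ltn_neqAle eq_sym kj.
Qed.

Lemma bounded_max (T : Type) (Q : T -> Prop) (u : T -> nat) (B : nat) (x0 : T) :
  Q x0 -> (forall x, Q x -> u x <= B) -> exists2 x1, Q x1 & forall x, Q x -> u x <= u x1.
Proof.
move=> Qx0 uB; have [k leB] := ubnP (B - u x0).
elim: k => // k IH in x0 Qx0 leB *.
have [[x1 [Qx1 lt01]]|nx] := classic (exists x, Q x /\ u x0 < u x).
  apply: (IH x1) => //; rewrite -ltnS; apply: leq_trans leB; rewrite ltnS.
  by rewrite ltn_sub2l // (leq_trans lt01) ?uB.
exists x0 => // x Qx; rewrite leqNgt; apply/negP => lt0.
by apply: nx; exists x.
Qed.

(** Coordinatewise addition, not ordinal addition: it embeds the block of [a] at height [j] into the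
    elements of that block that are not below [a]. *)
Definition shift d (j : nat) (a x : Ord d) : Ord d :=
  [ffun k : 'I_d => if k < j then x k + a k else x k].

Lemma agree_shift d j (a x : Ord d) : agree j (shift j a x) x.
Proof. by move=> k jk; rewrite ffunE ltnNge jk. Qed.

Lemma shift_lt d j (a x y : Ord d) : ord_lt x y -> ord_lt (shift j a x) (shift j a y).
Proof.
move=> [k [lt_xy Hk]]; exists k; split=> [|l kl]; rewrite !ffunE; last by rewrite Hk.
by case: ifP => // _; rewrite ltn_add2r.
Qed.

Lemma shift_ge d j (a x : Ord d) : agree j a x -> ~ ord_lt (shift j a x) a.
Proof.
move=> ax [k []]; rewrite ffunE; case: (ltnP k j) => [_|jk]; first by rewrite ltnNge leq_addl.
by rewrite ax // ltnn.
Qed.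

(** The statement is local to one block so that induction on [j] can be applied to its sub-blocks.
    Each sub-block yields a large child of [z], and the coordinates of these children increase
    strictly, hence without bound. *)
Lemma embedding_large d j (x z : Ord d) (f : Ord d -> Ord d) (S : Ord d -> Prop) :
  j <= d ->
  (forall y, agree j y x -> S (f y) /\ agree j (f y) z) ->
  (forall y y', agree j y x -> agree j y' x -> ord_lt y y' -> ord_lt (f y) (f y')) ->
  large S j z.
Proof.
elim: j x z f S => [|j IH] x z f S jd fS fmono /=.
  have [Sf fz] := fS x (fun _ _ => erefl).
  by have <- : f x = z by apply/ffunP => k; apply: fz.
pose jo := Ordinal jd; pose u y := f y jo.
have u_mono y y' : agree j.+1 y x -> agree j.+1 y' x -> ord_lt y y' -> u y <= u y'.
  (* [f y] and [f y'] agree above [jo], so the coordinate that decides their order is [jo] or a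
     lower one. *)
  move=> yx y'x yy'; have [k [lt_k eq_k]] := fmono _ _ yx y'x yy'.
  have [_ fyz] := fS _ yx; have [_ fyz'] := fS _ y'x.
  case: (ltngtP k jo) => [kj|jk|/val_inj kj]; first by rewrite /u eq_k.
    by move: lt_k; rewrite fyz // fyz' // ltnn.
  by rewrite /u -kj ltnW.
have lt_jo y y' : agree j.+1 y x -> agree j.+1 y' x -> y jo < y' jo -> ord_lt y y'.
  by move=> yx y'x lt_yy'; exists jo; split=> // k jk; rewrite yx ?y'x.
have updx a : agree j.+1 (upd x j a) x := @agree_upd_self _ _ _ _.
have updo a : upd x j a jo = a by rewrite ffunE eqxx.
have blockx y a : agree j y (upd x j a) -> agree j.+1 y x.
  by move=> ya; apply: agree_trans (agreeW _ ya) (updx a).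
have blocko y a : agree j y (upd x j a) -> y jo = a by move=> ya; rewrite ya ?updo.
(* On the block [y j = a] the coordinate [j] of [f y] is monotone and bounded, hence
   eventually constant; a tail of the block is again a copy of the whole block. *)
have step a : exists v, [/\ exists2 y, agree j y (upd x j a) & u y = v,
    large S j (upd z j v) & forall y, agree j.+1 y x -> a < y jo -> v < u y].
  have [y0 y0a y0max] : exists2 y0, agree j y0 (upd x j a) &
      forall y, agree j y (upd x j a) -> u y <= u y0.
    (* The bound comes from a point of the next sub-block, which lies above all of this one. *)
    apply: (@bounded_max _ _ _ (u (upd x j a.+1)) (upd x j a)) => // y ya.
    apply: u_mono (updx _) _; first exact: blockx ya.
    by apply: lt_jo (updx _) _; [apply: blockx ya | rewrite (blocko _ _ ya) updo].
  pose h := shift j y0.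
  have ha y : agree j y (upd x j a) -> agree j (h y) (upd x j a).
    by move=> ya; apply: agree_trans ya; apply: agree_shift.
  have uh y : agree j y (upd x j a) -> u (h y) = u y0.
    move=> ya; apply/eqP; rewrite eqn_leq y0max /=; last exact: ha.
    have [->//|/eqP/ord_lt_total[/shift_ge[]|lt_h]] := eqVneq (h y) y0.
      by move=> k jk; rewrite y0a // ya.
    by apply: u_mono lt_h; [apply: blockx y0a | apply: blockx (ha _ ya)].
  have fh y : agree j y (upd x j a) -> agree j (f (h y)) (upd z j (u y0)).
    move=> ya; apply: (agree_updr (jd := jd)); last exact: uh.
    by have [] := fS _ (blockx _ _ (ha _ ya)).
  have fh_mono y y' : agree j y (upd x j a) -> agree j y' (upd x j a) -> ord_lt y y' ->
      ord_lt (f (h y)) (f (h y')).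
    by move=> ya y'a yy'; apply: fmono (shift_lt _ _ yy'); apply: blockx (ha _ _).
  exists (u y0); split; first by exists y0.
    apply: (IH (upd x j a) _ (f \o h)) => //; first exact: ltnW.
    by move=> y ya; split; [have [] := fS _ (blockx _ _ (ha _ ya)) | apply: fh].
  move=> y yx lt_ay; have lt_block y' : agree j y' (upd x j a) -> ord_lt y' y.
    by move=> y'a; apply: lt_jo => //; [apply: blockx y'a | rewrite (blocko _ _ y'a)].
  have le_u : u y0 <= u y := u_mono _ _ (blockx _ _ y0a) yx (lt_block _ y0a).
  rewrite ltn_neqAle le_u andbT.
  (* If equality held, [f y] would lie in the node where the image of the shifted sub-block is
     large, hence cofinal. Some [f (h y')] would then not be below [f y], although [h y'] is below
     [y]. *)
  apply/eqP => uy.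
  have L : large (fun w => exists2 y', agree j y' (upd x j a) & f (h y') = w) j (upd z j (u y0)).
    apply: (IH (upd x j a) _ (f \o h)) => //; first exact: ltnW.
    by move=> y' y'a; split; [exists y' | apply: fh].
  have [|_ [y' y'a <-] [_]] := large_cofinal (w := f y) (ltnW jd) _ L.
    by apply: (agree_updr (jd := jd)); first have [] := fS _ yx.
  by apply; apply: fmono (lt_block _ (ha _ y'a)) => //; apply: blockx (ha _ y'a).
have unbounded a : exists2 v, a <= v & [/\ exists2 y, agree j y (upd x j a) & u y = v,
    large S j (upd z j v) & forall y, agree j.+1 y x -> a < y jo -> v < u y].
  elim: a => [|a [v av [_ _ Hv]]]; first by have [v] := step 0; exists v.
  have [v' Hv'] := step a.+1; exists v' => //; case: Hv' => -[y ya <-] _ _.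
  by apply: leq_ltn_trans av (Hv _ _ _); [apply: blockx ya | rewrite (blocko _ _ ya)].
by move=> N; have [v Nv [_ L _]] := unbounded N.+1; exists v.
Qed.

(** At height [d] every [agree] condition is vacuous, so the block is all of omega^d. *)
Corollary embedding_large_image d (S : Ord d -> Prop) (x : Ord d) :
  ord_equiv_sub S -> large S d x.
Proof.
case=> f [f_mono Sf]; apply: (@embedding_large _ _ x x f) => // [y _|y y' _ _]; last exact: f_mono.
by split; [apply/Sf; exists y | move=> k; rewrite leqNgt ltn_ord].
Qed.

(** * Prescribed comparisons in a large subtree *)

Definition paths d (I : Type) (r : I * 'I_d -> nat) (F : nat -> nat) (i : I) : Ord d :=
  [ffun j => F (r (i, j))].

(* Greedy: the values of [F] are chosen one after the other; at each stage the coordinates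
   with rank below [m] form, for every [i], a node of the large tree. *)
Lemma large_realizes d (I : Type) (S : Ord d -> Prop) (r : I * 'I_d -> nat) (M : nat) :
  (forall x, large S d x) ->
  (forall x, r x < M) ->
  (forall i (j j' : 'I_d), j' < j -> r (i, j) < r (i, j')) ->
  (forall i i' j j', r (i, j) = r (i', j') -> j = j') ->
  (forall i i' (j j' : 'I_d), j' < j -> r (i, j') = r (i', j') -> r (i, j) = r (i', j)) ->
  exists F, (forall a b, a < b < M -> F a < F b) /\ forall i, S (paths r F i).
Proof.
move=> SL rM r_dec r_lvl r_up.
(* [J] counts the coordinates of path [i] still to be chosen. They are the lowest ones, because
   ranks decrease as the exponent grows. *)
suff H m : exists F, (forall a b, a < b < m -> F a < F b) /\
    forall i J, J <= d -> (forall j : 'I_d, (j < J) = (m <= r (i, j))) ->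
      large S J (paths r F i).
  have [F [Fi SF]] := H M; exists F; split=> // i.
  by apply: (SF i 0) => // j; rewrite ltn0 leqNgt rM.
elim: m => [|m [F [Fi LF]]].
  exists id; split=> [a b|i J Jd HJ]; first by rewrite andbC.
  have -> // : J = d; apply/eqP; rewrite eqn_leq Jd leqNgt; apply/negP => ltJ.
  by have := HJ (Ordinal ltJ); rewrite ltnn leq0n.
pose B := \max_(a < m) F a.
pose F' v := fun a => if a == m then v else F a.
have F'i v : B < v -> forall a b, a < b < m.+1 -> F' v a < F' v b.
  move=> Bv a b /andP[ab]; rewrite ltnS leq_eqVlt /F' => /orP[/eqP bm|bm].
    rewrite bm in ab *; rewrite eqxx ltn_eqF //; apply: leq_ltn_trans Bv.
    exact: (leq_bigmax (F := fun a : 'I_m => F a) (Ordinal ab)).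
  by rewrite !ltn_eqF ?Fi ?ab // (ltn_trans ab).
have r_inj i j j' : r (i, j) = r (i, j') -> j = j' by apply: r_lvl.
(* Paths without a coordinate of rank [m] are not affected by the value of [F m]. *)
have stay v i J : J <= d -> (forall j : 'I_d, (j < J) = (m.+1 <= r (i, j))) ->
    (forall j, r (i, j) <> m) -> large S J (paths r (F' v) i).
  move=> Jd HJ ni; apply: (@large_agree _ _ _ (paths r F i)); last first.
    by apply: LF => // j; rewrite HJ [RHS]leq_eqVlt; case: eqP => // /esym e; case: (ni _ e).
  by move=> k Jk; rewrite !ffunE /F'; case: eqP => // e; case: (ni _ e).
have [[[i0 j0] r0]|nm] := classic (exists x, r x = m); last first.
  exists (F' B.+1); split; first exact: F'i.
  by move=> i J Jd HJ; apply: stay => // j rm; apply: nm; exists (i, j).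
have /(_ B) [v [Bv Lv]] : large S j0.+1 (paths r F i0).
  apply: LF => // j; rewrite -r0 ltnS; case: (ltngtP j j0) => [lt|gt|/val_inj->].
  - by rewrite ltnW ?r_dec.
  - by rewrite leqNgt r_dec.
  - by rewrite leqnn.
exists (F' v); split; first exact: F'i.
move=> i J Jd HJ; have [[j rj]|ni] := classic (exists j, r (i, j) = m); last first.
  by apply: stay => // j rm; apply: ni; exists j.
have jj0 : j = j0 by apply: (r_lvl i i0); rewrite r0.
subst j.
have -> : J = j0.
  apply/eqP; rewrite eqn_leq; apply/andP; split; first by rewrite leqNgt HJ rj ltnn.
  rewrite leqNgt; apply/negP => ltJ.
  have := HJ (Ordinal (ltn_trans ltJ (ltn_ord j0))); rewrite ltnn -rj.
  by rewrite r_dec.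
apply: large_agree Lv => k jk; rewrite !ffunE /F'; case: eqP => [kj|/eqP kj].
  by have -> : k = j0 by [apply: val_inj]; rewrite rj eqxx.
have lt_jk : j0 < k by rewrite ltn_neqAle eq_sym kj.
(* By [r_up], a path that has a coordinate of rank [m] shares all higher coordinates with path [i0].
   Both pass through the same node, so the same [v] serves both. *)
rewrite (r_up i i0 k j0) ?r0 // ltn_eqF // -r0; exact: r_dec.
Qed.

(** * Ranks in a finite total preorder *)

Definition isrep (I : finType) (le : I -> I -> bool) (y : I) :=
  [forall z, le z y && le y z ==> (enum_rank y <= enum_rank z)].

(* Counting one representative per class makes the ranks consecutive, so that [rk] is the
   position in the duplicate-free sorted list of values (see [rk_realize]). *)
Definition rk (I : finType) (le : I -> I -> bool) (x : I) :=
  #|[pred y | isrep le y && ~~ le x y]|.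

Lemma eq_rk (I : finType) (le le' : I -> I -> bool) : le =2 le' -> rk le =1 rk le'.
Proof.
move=> E x; apply: eq_card => y; rewrite !inE E; congr (_ && _).
by apply: eq_forallb => z; rewrite !E.
Qed.

Lemma rep_exists (I : finType) (le : I -> I -> bool) (x : I) :
  reflexive le -> transitive le -> exists y, [/\ isrep le y, le x y & le y x].
Proof.
move=> le_refl le_tr; pose Q := [pred y | le x y && le y x].
have Qx : Q x by rewrite /= le_refl.
case: (arg_minnP (fun y => val (enum_rank y)) Qx) => y /andP[xy yx] ymin.
exists y; split=> //; apply/forallP => z; apply/implyP => /andP[zy yz].
by apply: ymin; rewrite /= (le_tr _ _ _ xy yz) (le_tr _ _ _ zy yx).
Qed.

Lemma rk_bound (I : finType) (le : I -> I -> bool) (x : I) :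
  reflexive le -> transitive le -> rk le x < #|I|.
Proof.
move=> le_refl le_tr; have [y [ry xy yx]] := rep_exists x le_refl le_tr.
by apply/proper_card/properP; split; [apply/subsetP | exists y; rewrite // !inE xy andbF].
Qed.

Lemma rk_le (I : finType) (le : I -> I -> bool) : reflexive le -> transitive le ->
  total le -> forall x y, (rk le x <= rk le y) = le x y.
Proof.
move=> le_refl le_tr le_tot x y; have [xy|nxy] := boolP (le x y).
  apply/subset_leq_card/subsetP => z; rewrite !inE => /andP[-> /=].
  by apply: contra; apply: le_tr.
apply/negbTE; rewrite -ltnNge; apply/proper_card/properP; split.
  apply/subsetP => z; rewrite !inE => /andP[-> /=]; apply: contra => xz.
  have /orP[yx|xy] := le_tot y x; first exact: le_tr yx xz.
  by rewrite xy in nxy.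
have [z [rz yz zy]] := rep_exists y le_refl le_tr.
exists z; rewrite !inE rz ?yz //=.
by apply: contra nxy => xz; apply: le_tr xz zy.
Qed.

Lemma index_sorted_ltn (s : seq nat) v :
  sorted ltn s -> v \in s -> index v s = count (ltn^~ v) s.
Proof.
elim: s => //= a s IH a_s; rewrite inE.
have lt_a : all (ltn a) s by apply: order_path_min a_s; apply: ltn_trans.
case: (eqVneq v a) => [->|va] /= vs.
  rewrite ltnn add0n; apply/esym/eqP; rewrite -leqn0 leqNgt -has_count.
  by apply/hasPn => u /(allP lt_a) /ltnW; rewrite leqNgt.
have /= -> := allP lt_a v vs; by rewrite IH // (path_sorted a_s).
Qed.

(** The distinct values of [K] in increasing order come first in [e]. Larger numbers pad the list to
    length [#|I|], since Ramsey's theorem concerns lists of one fixed length. *)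
Lemma rk_realize (I : finType) (K : I -> nat) : exists e,
  [/\ size e = #|I|, sorted ltn e &
   forall x, nth 0 e (rk (fun x y => K x <= K y) x) = K x].
Proof.
set le := fun x y : I => K x <= K y.
pose e0 := sort leq [seq K y | y <- enum I & isrep le y].
have le_refl : reflexive le by move=> x; apply: leqnn.
have le_tr : transitive le by move=> y x z; apply: leq_trans.
have e0_sorted : sorted ltn e0.
  rewrite ltn_sorted_uniq_leq (sort_sorted leq_total) andbT sort_uniq.
  rewrite map_inj_in_uniq; first exact/filter_uniq/enum_uniq.
  move=> y z.
  rewrite !mem_filter => /andP[/forallP ry _] /andP[/forallP rz _] yz.
  apply: enum_rank_inj; apply: val_inj; apply/eqP; rewrite eqn_leq.
  by have := ry z; have := rz y; rewrite /le yz leqnn /= => -> ->.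
have size_e0 : size e0 <= #|I|.
  by rewrite size_sort size_map size_filter cardE count_size.
pose N := (\max_x K x).+1.
exists (e0 ++ iota N (#|I| - size e0)); split.
- by rewrite size_cat size_iota subnKC.
- have e0N : all (ltn^~ N) e0.
    apply/allP => _ /[!mem_sort] /mapP[y _ ->].
    by rewrite /= ltnS leq_bigmax.
  have ltn_tr : transitive ltn by move=> y x z; apply: ltn_trans.
  rewrite sorted_pairwise // pairwise_cat -!sorted_pairwise //.
  rewrite e0_sorted iota_ltn_sorted /= andbT.
  apply/allrelP => a b /(allP e0N) aN; rewrite mem_iota => /andP[Nb _].
  exact: leq_trans aN Nb.
- move=> x; have [y [ry xy yx]] := rep_exists x le_refl le_tr.
  have xe : K x \in e0.
    rewrite mem_sort; apply/mapP; exists y; first by rewrite mem_filter ry mem_enum.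
    by apply/eqP; rewrite eqn_leq; apply/andP.
  have Er : rk le x = index (K x) e0.
    rewrite (index_sorted_ltn e0_sorted xe) count_sort count_map count_filter.
    rewrite /rk cardE -size_filter enumT /enum_mem; congr size.
    by apply: eq_filter => z; rewrite !inE /le -ltnNge andbC.
  by rewrite nth_cat Er index_mem xe nth_index.
Qed.

(** * The lower bound *)

(** For [d = 0] the constant value excludes increasing keys on two or more indices, just as
    condition (1) does when [Y] can only take one value. *)
Definition key d : Ord d -> nat := if d is d'.+1 then fun x => x ord0 else fun=> 0.

Lemma keyE d (x : Ord d) (j : 'I_d) : val j = 0 -> key x = x j.
Proof. by case: d x j => [|d] x j j0; [case: j j0 | congr (x _); apply: val_inj]. Qed.

Definition kle d (x y : Ord d) := key x <= key y.

Definition order_type n d (s : n.-tuple (Ord d)) : CRdata n d 1 :=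
  ([ffun=> ord0], [ffun x => [ffun y => tnth s x.1 x.2 <= tnth s y.1 y.2]]).

Definition pattern n d (s : n.-tuple (Ord d)) := order_type (sort_tuple (@kle d) s).

Definition key_increasing n d (s : n.-tuple (Ord d)) :=
  forall i i' : 'I_n, i < i' -> key (tnth s i) < key (tnth s i').

Lemma isCR_elim n d (p : CRdata n d 1) : isCR p ->
  [/\ reflexive (fun x y => p.2 x y), transitive (fun x y => p.2 x y),
      total (fun x y => p.2 x y) &
  [/\ forall i i' : 'I_n, i < i' -> exists2 j : 'I_d, val j = 0 & ~~ p.2 (i', j) (i, j),
      forall i (j j' : 'I_d), j' < j -> ~~ p.2 (i, j') (i, j),
      forall i i' j j', p.2 (i, j) (i', j') && p.2 (i', j') (i, j) -> j = j' &
      forall i i' (j j' : 'I_d), val j = j'.+1 ->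
        p.2 (i, j') (i', j') && p.2 (i', j') (i, j') ->
        p.2 (i, j) (i', j) && p.2 (i', j) (i, j)]].
Proof.
case/andP=> /forallP h1 /andP[/forallP h2 /andP[/forallP h3]].
case/andP=> /forallP c1 /andP[_ /andP[/forallP c3 /andP[/forallP c4 /forallP c5]]].
split=> [x|y x z xy yz|x y|]; first exact: h1.
- by have /forallP/(_ y)/forallP/(_ z) := h2 x; rewrite xy yz.
- by have /forallP/(_ y) := h3 x.
split=> [i i' ii'|i j j' jj'|i i' j j' e|i i' j j' jj' e].
- have /forallP/(_ i') := c1 i; rewrite ii' /=.
  clear; case: d p => [|d] p; first by rewrite !ord1 ltnn.
  by move/forallP/(_ ord0) => /= /andP[_ ?]; exists ord0.
- by have /forallP/(_ j)/forallP/(_ j') := c3 i; rewrite jj' => /andP[].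
- by have /forallP/(_ i')/forallP/(_ j)/forallP/(_ j') := c4 i; rewrite e => /eqP.
- have /forallP/(_ i')/forallP/(_ j)/forallP/(_ j') := c5 i.
  by rewrite jj' eqxx e /=; rewrite implybF negbK.
Qed.

Lemma isCR_order_type n d (s : n.-tuple (Ord d)) : key_increasing s ->
  (forall i (j j' : 'I_d), j' < j -> tnth s i j < tnth s i j') ->
  (forall i i' (j j' : 'I_d), tnth s i j = tnth s i' j' -> j = j') ->
  (forall i i' (j j' : 'I_d), j' < j ->
     tnth s i j' = tnth s i' j' -> tnth s i j = tnth s i' j) ->
  isCR (order_type s).
Proof.
move=> c1 c3 c4 c5.
have leE x y : (order_type s).2 x y = (tnth s x.1 x.2 <= tnth s y.1 y.2).
  by rewrite !ffunE.
apply/andP; split; first by apply/forallP => x; rewrite leE leqnn.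
apply/andP; split.
  apply/forallP => x; apply/forallP => y; apply/forallP => z; rewrite !leE.
  by apply/implyP => xy; apply/implyP; apply: leq_trans xy.
apply/andP; split.
  by apply/forallP => x; apply/forallP => y; rewrite !leE; apply: leq_total.
apply/andP; split.
  apply/forallP => i; apply/forallP => i'; apply/implyP => /c1.
  case: d s {c3 c4 c5 c1} leE => [//|d] s leE lt_key.
  apply/forallP => j; apply/implyP => /eqP j0.
  by rewrite !leE -!(keyE _ j0) -ltnNge ltnW.
apply/andP; split.
  by do 3!apply/forallP => ?; apply/implyP => _; rewrite !ffunE.
apply/andP; split.
  apply/forallP => i; apply/forallP => j; apply/forallP => j'; apply/implyP => /(c3 i) lt_j.
  by rewrite !leE -ltnNge ltnW.
apply/andP; split.
  apply/forallP => i; apply/forallP => i'; apply/forallP => j; apply/forallP => j'.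
  by apply/implyP; rewrite !leE -eqn_leq => /eqP/c4/eqP.
apply/forallP => i; apply/forallP => i'; apply/forallP => j; apply/forallP => j'.
apply/implyP => /eqP jj'; rewrite !leE -!eqn_leq.
by apply/implyP; apply: contra => /eqP e; apply/eqP; apply: c5 e; rewrite jj'.
Qed.

(** The ranks in [p] satisfy the hypotheses of [large_realizes]: (3) makes them decrease along each
    path, (4) separates the exponents, and (5) carries ties upwards. *)
Lemma order_type_realized n d (p : CRdata n d 1) (S : Ord d -> Prop) :
  isCR p -> (forall x, large S d x) -> exists s : n.-tuple (Ord d),
  [/\ forall i, S (tnth s i), key_increasing s & order_type s = p].
Proof.
case/isCR_elim=> le_refl le_tr le_tot [c1 c3 c4 c5] SL.
set le := fun x y => p.2 x y in le_refl le_tr le_tot.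
have rkE x y : (rk le x <= rk le y) = p.2 x y by rewrite rk_le.
have rk_eq x y : rk le x = rk le y -> p.2 x y && p.2 y x.
  by move=> e; rewrite -!rkE e leqnn.
have eq_rk x y : p.2 x y && p.2 y x -> rk le x = rk le y.
  by rewrite -!rkE -eqn_leq => /eqP.
have rk_lt x : rk le x < #|{: 'I_n * 'I_d}| by apply: rk_bound.
(* Condition (5) lifts a tie by one exponent only, hence the induction. *)
have up i i' (j j' : 'I_d) : j' < j -> rk le (i, j') = rk le (i', j') ->
    rk le (i, j) = rk le (i', j).
  case: j => j jd /= lt_j e; elim: j jd lt_j => // j IH jd; rewrite ltnS => le_j.
  apply/eq_rk/(c5 _ _ _ (Ordinal (ltnW jd))) => //; apply: rk_eq.
  move: le_j; rewrite leq_eqVlt => /orP[/eqP j'j|]; last exact: IH.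
  by have -> : Ordinal (ltnW jd) = j' by apply: val_inj.
have [||F [Fi SF]] := large_realizes SL rk_lt _ _ up.
- by move=> i j j' jj'; rewrite ltnNge rkE c3.
- by move=> i i' j j' /rk_eq /c4.
have FE x y : (F (rk le x) <= F (rk le y)) = p.2 x y.
  rewrite -rkE; case: (ltngtP (rk le x) (rk le y)) => [lt|lt|->].
  - by rewrite ltnW // Fi // lt rk_lt.
  - by apply/negbTE; rewrite -ltnNge Fi // lt rk_lt.
  - exact: leqnn.
exists [tuple paths (rk le) F i | i < n]; split=> [i|i i' /c1[j j0 nle]|].
- by rewrite tnth_mktuple.
- by rewrite !tnth_mktuple !(keyE _ j0) !ffunE ltnNge FE.
case: p {c1 c3 c4 c5 SL up Fi SF} @le le_refl le_tr le_tot rkE rk_eq eq_rk rk_lt FE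
  => Y q le _ _ _ _ _ _ _ FE.
congr pair; apply/ffunP => x; rewrite !ffunE; first by rewrite [RHS]ord1.
by apply/ffunP => y; rewrite ffunE !tnth_mktuple !ffunE FE -!surjective_pairing.
Qed.

Lemma key_increasing_sorted n d (s : n.-tuple (Ord d)) : key_increasing s ->
  sorted (fun x y => key x < key y) s.
Proof.
move=> si; rewrite sorted_pairwise; last by move=> y x z; apply: ltn_trans.
case: n s si => [|n] s si; first by rewrite tuple0.
have x0 := tnth s ord0; apply/(pairwiseP x0) => i j.
rewrite !inE size_tuple => ni nj ij.
by have := si (Ordinal ni) (Ordinal nj) ij; rewrite !(tnth_nth x0).
Qed.

Lemma sort_increasing n d (s : n.-tuple (Ord d)) : uniq s ->
  forall i i' : 'I_n, i < i' ->
  ord_lt (tnth (sort_tuple (@leb d) s) i) (tnth (sort_tuple (@leb d) s) i').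
Proof.
move=> us i i' ii'; pose x0 := tnth s i.
have : leb (tnth (sort_tuple (@leb d) s) i) (tnth (sort_tuple (@leb d) s) i').
  rewrite !(tnth_nth x0).
  have := sorted_ltn_nth (@leb_trans d) x0 (sort_sorted (@leb_total d) s).
  by apply; rewrite ?inE ?size_sort ?size_tuple.
rewrite /leb !(tnth_nth x0) nth_uniq ?sort_uniq ?size_sort ?size_tuple //.
by rewrite ltn_eqF //= => /ltbP.
Qed.

(** Colourings are evaluated on tuples in ordinal order, whereas CRs list a set by key. As the keys
    are distinct, sorting by key recovers [s] from its ordinal rearrangement. *)
Lemma pattern_sort n d (s : n.-tuple (Ord d)) : key_increasing s ->
  uniq s /\ pattern (sort_tuple (@leb d) s) = order_type s.
Proof.
move=> si; have so := key_increasing_sorted si; split.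
  by apply: sorted_uniq so => [y x z|x]; [apply: ltn_trans | rewrite ltnn].
have inj : {in s &, injective (@key d)}.
  move=> _ _ /tnthP[i ->] /tnthP[i' ->] e; congr tnth; apply: val_inj.
  by case: (ltngtP i i') => [/si|/si|//]; rewrite e ltnn.
congr order_type; apply: val_inj => /=.
rewrite -[RHS](sorted_sort (leT := @kle d)); first 1 last.
- by move=> y x z; apply: leq_trans.
- by apply: sub_sorted so => x y; apply: ltnW.
apply/perm_sort_inP; last by rewrite perm_sort.
- by move=> x y _ _; apply: leq_total.
- by move=> y x z _ _ _; apply: leq_trans.
- by move=> x y; rewrite !mem_sort => xs ys xy; apply: inj => //; apply/eqP; rewrite eqn_leq.
Qed.

Lemma lower_bound n d t : T_ok n d t -> P n d <= t.
Proof.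
pose p0 : CRdata n d 1 := ([ffun=> ord0], [ffun=> [ffun=> false]]).
have c_gt0 : 0 < #|{: CRdata n d 1}| by apply/card_gt0P; exists p0.
case/(_ _ c_gt0 (fun s => enum_rank (pattern s))) => S [SE [A [At SA]]].
(* It suffices that the colour [enum_rank p] of every CR [p] lies in [A]. *)
apply: leq_trans At; rewrite /P /Pk -(card_imset [pred p | isCR p] enum_rank_inj).
apply/subset_leq_card/subsetP => _ /imsetP[p CRp ->].
have [s [Ss si <-]] := order_type_realized CRp (fun x => @embedding_large_image _ _ x SE).
have [us <-] := pattern_sort si.
apply: SA; split=> [|i]; first exact: sort_increasing.
have /tnthP[i' ->] : tnth (sort_tuple (@leb d) s) i \in s by rewrite -(mem_sort (@leb d)) mem_tnth.
exact: Ss.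
Qed.

(** * The upper bound *)

(** [CodeSeq.code] maps [a :: s] to 2^a * (2 * code s + 1). It is therefore injective, exceeds the
    code of the tail, and increases with the head when the tail is fixed. *)
Definition label d (x : Ord d) (j : nat) : nat := CodeSeq.code (drop j (codom x)).

Lemma nth_codom_ord d (x : Ord d) (k : 'I_d) : nth 0 (codom x) k = x k.
Proof. by rewrite (nth_map k) ?size_enum_ord // nth_ord_enum. Qed.

Lemma label_agree d (x y : Ord d) j : agree j x y -> label x j = label y j.
Proof.
move=> xy; congr CodeSeq.code; apply: (@eq_from_nth _ 0).
  by rewrite !size_drop !size_codom.
move=> i; rewrite size_drop size_codom card_ord ltn_subRL => ji.
by rewrite !nth_drop -[j + i]/(val (Ordinal ji)) !nth_codom_ord xy //= leq_addr.
Qed.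

Lemma label_inj d (x y : Ord d) (j j' : 'I_d) :
  label x j = label y j' -> j = j' /\ agree j x y.
Proof.
move/(can_inj CodeSeq.codeK) => e.
(* The decoded lists have lengths [d - j] and [d - j'], so the code also determines the exponent. *)
have jj' : j = j'.
  apply: val_inj; move/(congr1 size): e; rewrite !size_drop !size_codom card_ord => e.
  by rewrite /= -(subKn (ltnW (ltn_ord j))) e subKn // ltnW.
split=> // k jk; have := congr1 (fun s => nth 0 s (k - j)) e.
by rewrite /= !nth_drop -jj' subnKC // !nth_codom_ord.
Qed.

Lemma labelE d (x : Ord d) (j : 'I_d) : label x j = 2 ^ x j * (label x j.+1).*2.+1.
Proof. by rewrite /label (drop_nth 0) ?size_codom ?card_ord // nth_codom_ord. Qed.

Lemma label_decr d (x : Ord d) (j j' : 'I_d) : j' < j -> label x j < label x j'.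
Proof.
case: j => j jd /=; elim: j jd => // j IH jd; rewrite ltnS => le_j'.
have lt_j : label x j.+1 < label x (Ordinal (ltnW jd)).
  rewrite labelE /= (leq_trans _ (leq_pmull _ _)) ?expn_gt0 //.
  by rewrite ltnS -addnn leq_addr.
move: le_j'; rewrite leq_eqVlt => /orP[/eqP -> //|/(IH (ltnW jd))].
exact: ltn_trans.
Qed.

Lemma label_lt d (x y : Ord d) (j : 'I_d) :
  agree j.+1 x y -> x j < y j -> label x j < label y j.
Proof.
by move=> xy lt_j; rewrite !labelE (label_agree xy) ltn_pmul2r // ltn_exp2l.
Qed.

(** For increasing [g] the range is the desired copy of omega^d. Decreasing labels give (3), and
    injectivity of the code gives (4) and (5). *)
Definition spread d (g : nat -> nat) (x : Ord d) : Ord d := [ffun j : 'I_d => g (label x j)].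

Lemma spread_lt d g (x y : Ord d) : incr g -> ord_lt x y -> ord_lt (spread g x) (spread g y).
Proof.
move=> gi [j [lt_j xy]]; exists j; split=> [|k jk]; rewrite !ffunE.
  exact/gi/label_lt.
by rewrite (@label_agree _ x y) // => l kl; rewrite xy // (leq_trans jk).
Qed.

(** The label at exponent 0 encodes every coefficient of [x]. *)
Lemma spread_key_inj d g (x y : Ord d) : injective g ->
  key (spread g x) = key (spread g y) -> x = y.
Proof.
case: d x y => [|d] x y g_inj; first by move=> _; apply/ffunP => -[].
rewrite /= !ffunE => /g_inj/label_inj[_ xy].
by apply/ffunP => j; apply: xy.
Qed.

Lemma sort_tuple_id n d (s : n.-tuple (Ord d)) (t : n.-tuple (Ord d)) :
  (forall i i' : 'I_n, i < i' -> ord_lt (tnth s i) (tnth s i')) ->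
  perm_eq t s -> sort_tuple (@leb d) t = s.
Proof.
move=> si st; apply: val_inj => /=.
rewrite (elimT (perm_sortP (@leb_total d) (@leb_trans d) (@leb_anti d) _ _) st).
apply: sorted_sort; first exact: leb_trans.
rewrite sorted_pairwise; last exact: leb_trans.
case: n s t si {st} => [|n] s t si; first by rewrite tuple0.
have x0 := tnth s ord0; apply/(pairwiseP x0) => i j; rewrite !inE size_tuple => ni nj ij.
have /ltbP := si (Ordinal ni) (Ordinal nj) ij.
by rewrite !(tnth_nth x0) /leb => ->; rewrite orbT.
Qed.

Lemma sort_key_increasing n d (s : n.-tuple (Ord d)) : uniq s ->
  {in s &, injective (@key d)} -> key_increasing (sort_tuple (@kle d) s).
Proof.
move=> us key_inj i i' ii'; pose x0 := tnth s i.
have : kle (tnth (sort_tuple (@kle d) s) i) (tnth (sort_tuple (@kle d) s) i').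
  rewrite !(tnth_nth x0).
  have kle_tr : transitive (@kle d) by move=> y x z; apply: leq_trans.
  have := sorted_ltn_nth kle_tr x0 (sort_sorted _ s).
  by apply; rewrite ?inE ?size_sort ?size_tuple // => x y; apply: leq_total.
rewrite /kle leq_eqVlt => /orP[/eqP/key_inj|//].
have mem_s k : tnth (sort_tuple (@kle d) s) k \in s by rewrite -(mem_sort (@kle d)) mem_tnth.
move=> /(_ (mem_s _) (mem_s _)) /eqP; rewrite !(tnth_nth x0).
by rewrite nth_uniq ?sort_uniq ?size_sort ?size_tuple // ltn_eqF.
Qed.

Lemma upper_bound n d : T_ok n d (P n d).
Proof.
move=> c _ COL.
(* Entries of [e] are placed according to their ranks in [p]; [famE] shows that this rebuilds a
   tuple of the copy from its order type and its values. *)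
pose fam (p : CRdata n d 1) (e : seq nat) : n.-tuple (Ord d) :=
  [tuple paths (rk (fun x y => p.2 x y)) (nth 0 e) i | i < n].
(* A list is coloured by a whole function of [p], so one application of Ramsey's theorem treats all
   [p] at once. *)
have [g [gi [v gv]]] := infinite_ramsey #|{: 'I_n * 'I_d}|
  (fun e => [ffun p => COL (sort_tuple (@leb d) (fam p e))]).
have g_mono : {mono g : a b / a <= b} by apply: leq_mono.
have g_inj : injective g by apply: incn_inj.
exists (fun y => exists x, spread g x = y); split.
  by exists (spread g); split=> // x y; apply: spread_lt.
exists [set v p | p in [pred p | isCR p]]; split; first exact: leq_imset_card.
move=> s [si sS]; pose t := sort_tuple (@kle d) s.
have ts : perm_eq t s by rewrite /= perm_sort.
have s_uniq : uniq s.
  apply: contraT => /(uniqPn (spread g [ffun=> 0])).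
  move=> [i [i' [lt_ii' lt_i' e]]]; rewrite size_tuple in lt_i'.
  have := si (Ordinal (ltn_trans lt_ii' lt_i')) (Ordinal lt_i') lt_ii'.
  by rewrite !(tnth_nth (spread g [ffun=> 0])) /= e => /ord_lt_irr.
have /choice[X XE] : forall i, exists x, spread g x = tnth t i.
  by move=> i; have /tnthP[k ->] : tnth t i \in s by rewrite -(perm_mem ts) mem_tnth.
have tE i j : tnth t i j = g (label (X i) j) by rewrite -XE ffunE.
have t_key : key_increasing t.
  apply: sort_key_increasing => // _ _ /tnthP[i ->] /tnthP[i' ->].
  by have [[x <-] [y <-]] := (sS i, sS i') => /(spread_key_inj g_inj)->.
have CRt : isCR (order_type t).
  apply: isCR_order_type => // [i j j' jj'|i i' j j'|i i' j j' jj']; rewrite !tE.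
  - exact/gi/label_decr.
  - by move/g_inj/label_inj=> [].
  - move/g_inj/label_inj=> [_ XX]; congr g; apply: label_agree => k jk.
    by apply: XX; rewrite (leq_trans _ jk) // ltnW.
have [e [size_e e_sorted eK]] := rk_realize (fun x : 'I_n * 'I_d => label (X x.1) x.2).
have famE : fam (order_type t) (map g e) = t.
  apply: eq_from_tnth => i; rewrite tnth_mktuple; apply/ffunP => j; rewrite ffunE tE.
  (* As [g] is increasing, coefficients compare as their labels do, and the ranks become those for
     which [e] was built. *)
  rewrite (@eq_rk _ _ (fun x y : 'I_n * 'I_d => label (X x.1) x.2 <= label (X y.1) y.2)); last first.
    by move=> x y; rewrite !ffunE !tE g_mono.
  rewrite (nth_map 0) ?eK // size_e; apply: rk_bound => [x|y x z]; first exact: leqnn.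
  exact: leq_trans.
apply/imsetP; exists (order_type t) => //.
by rewrite -(gv e size_e e_sorted) ffunE famE (sort_tuple_id si ts).
Qed.

Theorem theorem8p4 (n d : nat) :
  (forall t, T_ok n d t -> P n d <= t) /\ T_is n d (P n d).
Proof.
split; first exact: lower_bound.
by split; [apply: upper_bound | apply: lower_bound].
Qed.
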